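(* Let $(\mathcal K,\varphi)$ be a left reflexive complete idempotent semiring, and let $(Y,X)$ be a predual pair over $\mathcal K$ with bracket $\langle\cdot\mid\cdot\rangle:Y\times X\to\mathcal K$. If $V\subset X$ is a complete subsemimodule whose elements are all closed, and if $x\in X$ is closed, then $$\langle{}^-P_V(x)\mid v\rangle=\langle{}^-x\mid v\rangle\quad\text{for all }v\in V,$$ and $$\langle{}^-P_V(x)\mid x\rangle=\langle{}^-x\mid x\rangle\iff x\in V .$$
   Context: A semiring $(\mathcal K,\oplus,\otimes,\varepsilon,e)$ is idempotent if $a\oplus a=a$ for all $a$. An idempotent commutative monoid carries the natural order $a\le b\iff a\oplus b=b$. An ordered set is complete if every subset $U$ has a least upper bound $\bigvee U$. A map $f$ between complete ordered sets is continuous if $f(\bigvee U)=\bigvee f(U)$ for every subset $U$ (including $U=\varnothing$). An idempotent semiring is complete if it is complete for its natural order and all its left and right multiplications are continuous. A right $\mathcal K$-semimodule is a commutative monoid $(X,\oplus,\varepsilon)$ with a right action satisfying $x(\lambda\mu)=(x\lambda)\mu$, $(x\oplus y)\lambda=x\lambda\oplus y\lambda$, $x(\lambda\oplus\mu)=x\lambda\oplus x\mu$, $x\varepsilon=\varepsilon$, $xe=x$; its addition is then idempotent. It is complete if it is complete for its natural order and the maps $x\mapsto x\lambda$ on $X$ and $\mu\mapsto v\mu$ from $\mathcal K$ to $X$ are all continuous. (Complete) left semimodules are defined dually. A map is linear if it preserves finite sums and commutes with the action. A predual pair $(Y,X)$ with values in $\mathcal K$ consists of a complete right $\mathcal K$-semimodule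 $X$, a complete left $\mathcal K$-semimodule $Y$, and a bracket $\langle\cdot\mid\cdot\rangle:Y\times X\to\mathcal K$ such that each map $y\mapsto\langle y\mid x\rangle$ is left linear and continuous and each map $x\mapsto\langle y\mid x\rangle$ is right linear and continuous. A complete idempotent semiring $\mathcal K$ with distinguished element $\varphi$ is left reflexive if $\varphi/(\lambda\backslash\varphi)=\lambda$ for all $\lambda\in\mathcal K$, where $\lambda\backslash\varphi=\max\{\mu\in\mathcal K\mid\lambda\mu\le\varphi\}$ and $\varphi/\lambda=\max\{\mu\in\mathcal K\mid\mu\lambda\le\varphi\}$. With this same $\varphi$: ${}^-x=\max\{y\in Y\mid\langle y\mid x\rangle\le\varphi\}$ for $x\in X$, and $y^-=\max\{x\in X\mid\langle y\mid x\rangle\le\varphi\}$ for $y\in Y$. An element of $X$ is closed if it is of the form $y^-$ for some $y\in Y$. A complete subsemimodule $V$ of $X$ is a subset stable under arbitrary suprema and under the action of scalars; $P_V(x)=\max\{v\in V\mid v\le x\}$. *)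

(* Defs.v *)
From HB Require Import structures.
From mathcomp Require Import all_boot all_algebra.
From mathcomp Require Import boolp classical_sets.

Set Implicit Arguments.
Unset Strict Implicit.
Unset Printing Implicit Defensive.

Import GRing.Theory.
Local Open Scope classical_set_scope.
Local Open Scope ring_scope.

(* Semirings are [pzSemiRingType]: not necessarily commutative, and 0 = 1 is  *)
(* allowed. A left K-semimodule is an [lSemiModType K]; a right K-semimodule  *)
(* is an [lSemiModType K^c] over the converse semiring, the right action of   *)
(* [l : K] on [x] being [l *: x], so that x (l m) = (x l) m.                  *)

Section NaturalOrder.
Variable T : nmodType.
Implicit Types (a b : T) (A : set T).

Definition natle a b : Prop := a + b = b.

Definition is_lub A a : Prop :=
  (forall b, A b -> natle b a) /\
  (forall c, (forall b, A b -> natle b c) -> natle a c).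

Definition is_max A a : Prop := A a /\ forall b, A b -> natle b a.

(* The default value 0 is taken only when [A] has no maximum. *)
Definition max_of A : T := xget 0 [set a | is_max A a].

Definition nat_complete : Prop := forall A, exists a, is_lub A a.

End NaturalOrder.

(* Between complete ordered sets this says f(\/ U) = \/ f(U) for every U,     *)
(* including the empty set.                                                   *)
Definition sup_continuous (T T' : nmodType) (f : T -> T') : Prop :=
  forall (U : set T) (s : T), is_lub U s -> is_lub (f @` U) (f s).

Record complete_idempotent_semiring (K : pzSemiRingType) : Prop := {
  idem_semiring : forall a : K, a + a = a;
  complete_semiring : nat_complete K;
  mull_continuous : forall a : K, sup_continuous (fun b : K => a * b);
  mulr_continuous : forall a : K, sup_continuous (fun b : K => b * a) }.

(* With R = K this is completeness of a left K-semimodule, with R = K^c that  *)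
(* of a right one. Idempotency of the addition of M follows from that of R.   *)
Record complete_semimodule (R : pzSemiRingType) (M : lSemiModType R) : Prop := {
  complete_semimod : nat_complete M;
  action_continuous : forall a : R, sup_continuous (fun x : M => a *: x);
  orbit_continuous : forall x : M, sup_continuous (fun a : R => a *: x) }.

(* [K^o] and [(K^c)^o] are K viewed as a left, resp. right, K-semimodule: the  *)
(* two scalability axioms say <l y | x> = l <y | x> and <y | x l> = <y | x> l. *)
Record predual_pair (K : pzSemiRingType) (Y : lSemiModType K)
    (X : lSemiModType K^c) (br : Y -> X -> K) : Prop := {
  predual_right : complete_semimodule X;
  predual_left : complete_semimodule Y;
  bracket_left_additive : forall x : X, nmod_morphism (br^~ x);
  bracket_left_scalable : forall x : X, scalable (br^~ x : Y -> K^o);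
  bracket_left_continuous : forall x : X, sup_continuous (br^~ x);
  bracket_right_additive : forall y : Y, nmod_morphism (br y);
  bracket_right_scalable : forall y : Y, scalable (br y : X -> (K^c)^o);
  bracket_right_continuous : forall y : Y, sup_continuous (br y) }.

(* lres a b = a \ b and rres b a = b / a. *)
Definition lres (K : pzSemiRingType) (a b : K) : K :=
  max_of [set m | natle (a * m) b].

Definition rres (K : pzSemiRingType) (b a : K) : K :=
  max_of [set m | natle (m * a) b].

Definition left_reflexive (K : pzSemiRingType) (phi : K) : Prop :=
  forall l : K, rres phi (lres l phi) = l.

Section Polarity.
Variables (K : pzSemiRingType) (phi : K).
Variables (Y : lSemiModType K) (X : lSemiModType K^c) (br : Y -> X -> K).

(* lpolar x is ^-x and rpolar y is y^-. *)
Definition lpolar (x : X) : Y := max_of [set y | natle (br y x) phi].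

Definition rpolar (y : Y) : X := max_of [set x | natle (br y x) phi].

Definition closed_elt (x : X) : Prop := exists y : Y, x = rpolar y.

End Polarity.

Record complete_subsemimodule (R : pzSemiRingType) (M : lSemiModType R)
    (V : set M) : Prop := {
  subsemimod_sup : forall (U : set M) (s : M), U `<=` V -> is_lub U s -> V s;
  subsemimod_action : forall (a : R) (v : M), V v -> V (a *: v) }.

(* P_V(x) *)
Definition proj_sub (M : nmodType) (V : set M) (x : M) : M :=
  max_of [set v | V v /\ natle v x].

(* Main.v *)
Require Import Defs.
From HB Require Import structures.
From mathcomp Require Import all_boot all_algebra.
From mathcomp Require Import boolp classical_sets.

Set Implicit Arguments.
Unset Strict Implicit.

Import GRing.Theory.
Local Open Scope ring_scope.

(** Closedness of [x] gives the Galois-type rule [<^-x | z> <= phi -> z <= x].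
    For [v] in [V], put [l = <^-x | v>] and [m = l \ phi]: then [v m] lies in
    [V] and below [x], hence below [P_V x], so [<^-P_V x | v> m <= phi].
    Residuating by [m] and using left reflexivity yields [<^-P_V x | v> <= l].
    The reverse inequality is antitonicity of the polar.
    If equality also holds at [x], then [<^-P_V x | x> <= phi], and closedness
    of [P_V x] gives [x <= P_V x]. *)

Lemma natle_trans (T : nmodType) (b a c : T) :
  natle a b -> natle b c -> natle a c.
Proof. by rewrite /natle => ab <-; rewrite addrA ab. Qed.

Lemma natle_anti (T : nmodType) (a b : T) : natle a b -> natle b a -> a = b.
Proof. by rewrite /natle => ab ba; rewrite -ab addrC. Qed.

Lemma natle_morph (T T' : nmodType) (f : T -> T') (a b : T) :
  nmod_morphism f -> natle a b -> natle (f a) (f b).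
Proof. by rewrite /natle => -[_ fD] ab; rewrite -fD ab. Qed.

Lemma is_max_max_of (T : nmodType) (A : set T) (a : T) :
  is_max A a -> is_max A (max_of A).
Proof.
move=> Aa.
by apply: (@xgetPex _ 0 (fun b => is_max A b)); exists a.
Qed.

Lemma is_lub_is_max (T : nmodType) (A : set T) (a : T) :
  is_lub A a -> A a -> is_max A a.
Proof. by case=> ubA _ Aa. Qed.

(** The supremum of the sublevel set belongs to it: by continuity its image is the supremum of
    values that are all below [b]. Both residuals and both polars are instances. *)
Lemma is_max_sublevel (T T' : nmodType) (f : T -> T') (b : T') :
  nat_complete T -> sup_continuous f ->
  is_max [set a | natle (f a) b]%classic
         (max_of [set a | natle (f a) b]%classic).
Proof.
move=> cT fc; have [s sP] := cT [set a | natle (f a) b]%classic.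
apply: (@is_max_max_of _ _ s); apply: is_lub_is_max => //=.
by case: (fc _ _ sP) => _; apply=> _ [a /= ab <-].
Qed.

(** The supremum of the candidates stays in [V] by stability under suprema, and below [x] because
    [x] bounds them all. *)
Lemma is_max_proj_sub (R : pzSemiRingType) (M : lSemiModType R) (V : set M)
    (x : M) :
  nat_complete M -> complete_subsemimodule V ->
  is_max [set v | V v /\ natle v x]%classic (proj_sub V x).
Proof.
move=> cM VM; have [s sP] := cM [set v | V v /\ natle v x]%classic.
apply: (@is_max_max_of _ _ s); apply: is_lub_is_max => //=; split.
  by apply: (subsemimod_sup VM _ sP) => v [].
by case: sP => _; apply=> v [].
Qed.

Section PredualPair.
Variables (K : pzSemiRingType) (phi : K).
Variables (Y : lSemiModType K) (X : lSemiModType K^c) (br : Y -> X -> K).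
Hypothesis brP : predual_pair br.

Lemma is_max_lpolar (x : X) :
  is_max [set y | natle (br y x) phi]%classic (lpolar phi br x).
Proof.
apply: (@is_max_sublevel _ _ (br^~ x)).
  exact: complete_semimod (predual_left brP).
exact: bracket_left_continuous brP x.
Qed.

Lemma is_max_rpolar (y : Y) :
  is_max [set x | natle (br y x) phi]%classic (rpolar phi br y).
Proof.
apply: is_max_sublevel; first exact: complete_semimod (predual_right brP).
exact: bracket_right_continuous brP y.
Qed.

Lemma natle_bracketl (x : X) (y z : Y) :
  natle y z -> natle (br y x) (br z x).
Proof. exact: (@natle_morph _ _ (br^~ x) _ _) (bracket_left_additive brP x). Qed.

Lemma natle_bracketr (y : Y) (x z : X) :
  natle x z -> natle (br y x) (br y z).
Proof. exact: natle_morph (bracket_right_additive brP y). Qed.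

(** Scaling in [(K^c)^o] is the converse product, so it unfolds to multiplication on the right in
    [K]. *)
Lemma bracketZr (y : Y) (m : K) (x : X) : br y ((m : K^c) *: x) = br y x * m.
Proof. exact: bracket_right_scalable brP y m x. Qed.

Lemma natle_lpolar (x z : X) :
  natle x z -> natle (lpolar phi br z) (lpolar phi br x).
Proof.
move=> xz; apply: (is_max_lpolar x).2.
by apply: natle_trans (is_max_lpolar z).1; apply: natle_bracketr.
Qed.

(** If [x] is the polar of [y], then [y] pairs with [x] below [phi], so [y] lies below
    [lpolar phi br x]. Hence [br y z] is below [phi] too, and [x] is the largest such element. *)
Lemma closed_natle (x z : X) :
  closed_elt phi br x -> natle (br (lpolar phi br x) z) phi -> natle z x.
Proof.
case=> y xE zP; have [xP x_max] := is_max_rpolar y.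
rewrite -xE in xP x_max.
apply: x_max; apply: natle_trans zP; apply: natle_bracketl.
exact: (is_max_lpolar x).2.
Qed.

End PredualPair.

(** Left reflexivity presents [l] as the residual of [phi] by [lres l phi], that is, as the largest
    solution [k] of the hypothesis. *)
Lemma left_reflexive_natle (K : pzSemiRingType) (phi l k : K) :
  complete_idempotent_semiring K -> left_reflexive phi ->
  natle (k * lres l phi) phi -> natle k l.
Proof.
move=> KP refl kP; rewrite -(refl l).
apply: (@is_max_sublevel _ _ (fun m => m * lres l phi) phi _ _).2 => //.
  exact: complete_semiring KP.
exact: mulr_continuous KP _.
Qed.

Lemma mul_lres_natle (K : pzSemiRingType) (phi l : K) :
  complete_idempotent_semiring K -> natle (l * lres l phi) phi.
Proof.
move=> KP; apply: (@is_max_sublevel _ _ (fun m => l * m) phi _ _).1.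
  exact: complete_semiring KP.
exact: mull_continuous KP _.
Qed.

(** Reflexivity of the natural order is idempotency of addition, inherited from the scalars through
    [x + x = (1 + 1) *: x]. *)
Lemma natle_refl_semimod (R : pzSemiRingType) (M : lSemiModType R) (x : M) :
  (1 + 1 = 1 :> R) -> natle x x.
Proof.
by move=> idR; rewrite /natle -[in LHS](scale1r x) -scalerDl idR
  scale1r.
Qed.

Unset Implicit Arguments.

Theorem theorem34 (K : pzSemiRingType) (phi : K)
    (Y : lSemiModType K) (X : lSemiModType K^c) (br : Y -> X -> K)
    (V : set X) (x : X) :
  complete_idempotent_semiring K ->
  left_reflexive phi ->
  predual_pair br ->
  complete_subsemimodule V ->
  (forall v : X, V v -> closed_elt phi br v) ->
  closed_elt phi br x ->
  (forall v : X, V v ->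
     br (lpolar phi br (proj_sub V x)) v = br (lpolar phi br x) v) /\
  (br (lpolar phi br (proj_sub V x)) x = br (lpolar phi br x) x <-> V x).
Proof.
move=> KP refl brP VP Vclosed xclosed.
have [[Vp px] p_max] :=
  is_max_proj_sub x (complete_semimod (predual_right brP)) VP.
set p := proj_sub V x in Vp px p_max *.
split=> [v Vv|]; last split=> [eq_x|Vx].
- apply: natle_anti; last by apply: natle_bracketl => //; apply: natle_lpolar.
  apply: (left_reflexive_natle KP refl).
  set m := lres _ _; rewrite -(bracketZr brP).
  (* Comparison with [br (lpolar phi br p) p], which is below [phi], leaves only [m *: v] below [p]
     to show. *)
  apply: natle_trans (is_max_lpolar phi brP p).1.
  apply: (natle_bracketr brP).
  apply: p_max; split; first exact: subsemimod_action VP _ _ Vv.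
  apply: (closed_natle brP xclosed).
  by rewrite (bracketZr brP); apply: mul_lres_natle.
- suff -> : x = p by [].
  apply: natle_anti => //; apply: (closed_natle brP (Vclosed _ Vp)).
  by rewrite eq_x; apply: (is_max_lpolar phi brP x).1.
(* When [x] is in [V], it is itself a candidate in the maximum defining [p]. *)
- suff -> : p = x by [].
  apply: natle_anti => //; apply: p_max; split => //.
  exact: (@natle_refl_semimod K^c X x (idem_semiring KP 1)).
Qed.
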